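(* Let $\phi$ be a second-order sentence over the vocabulary $\{\le\}\cup\{P_i\mid p_i\in\mathrm{AP}\}$. Then there exists a formula $\mathrm{Tr}(\phi)(\mathfrak a)$ of third-order arithmetic ($\Delta^3_0$), with a free third-order variable $\mathfrak a$ of type $((2))$, such that for all trace sets $T$: $$\mathcal M_T\models\phi\iff(\mathbb N,+,\times,\le,0,1)\models\mathrm{Tr}(\phi)(\mathcal A_T/\mathfrak a).$$
   Context: $\mathrm{AP}=\{p_0,p_1,\dots\}$; a trace is $t\in(2^{\mathrm{AP}})^\omega$, a trace set (team) is a set of traces. $\mathcal M_T$ has domain $T\times\mathbb N$, $(t,n)\le(t',m)$ iff $t=t'$ and $n\le m$, and $P_i=\{(t,j)\mid p_i\in t(j)\}$. Third-order arithmetic: a type is a tuple $\tau=(n_1,\dots,n_k)$ of positive integers; variables $\mathfrak a$ of type $\tau$ range over subsets of $\mathcal P(\mathbb N^{n_1})\times\dots\times\mathcal P(\mathbb N^{n_k})$; the language extends second-order logic over $\{+,\times,0,1,=,\le\}$ by atoms $\mathfrak a(A_1,\dots,A_k)$ ($A_i$ a relation variable of arity $n_i$) and quantification over third-order variables; $\Delta^3_0$ is the set of all such formulas. Encoding of $T$: a trace $t$ is encoded by $S_t=\{(j,k)\in\mathbb N^2\mid p_k\in t(j)\}$, and $\mathcal A_T=\{S_t\mid t\in T\}$, an object of type $((2))$. *)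

(* Defs.v *)
From mathcomp Require Import all_boot.
From mathcomp Require Import boolp classical_sets.
Set Implicit Arguments.
Unset Strict Implicit.
Unset Printing Implicit Defensive.
Local Open Scope classical_set_scope.

Fixpoint hlist (A : Type) (D : A -> Type) (s : seq A) : Type :=
  if s is a :: s' then (D a * hlist D s')%type else unit.

Fixpoint hmap (A : Type) (D E : A -> Type) (f : forall a, D a -> E a)
    (s : seq A) : hlist D s -> hlist E s :=
  match s with
  | [::] => fun=> tt
  | a :: s' => fun h => (f a h.1, hmap f h.2)
  end.

Record posnat := PosNat { pos_val :> nat; _ : 0 < pos_val }.

Record type3 := Type3 { arities :> seq posnat; _ : 0 < size arities }.

Inductive sort :=
| Ind
| Rel of posnat
| Third of type3.

(* Syntax is intrinsically scoped (de Bruijn), so that a sentence is a formula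
   in the empty context.  In particular satisfaction of a sentence is also
   meaningful in a structure with an empty domain, such as that of the empty
   trace set, where no total assignment of the first-order variables exists. *)
Inductive var : seq sort -> sort -> Type :=
| VZ (G : seq sort) (s : sort) : var (s :: G) s
| VS (G : seq sort) (s s' : sort) : var G s -> var (s' :: G) s.

Fixpoint lookup (D : sort -> Type) (G : seq sort) (s : sort) (x : var G s) :
    hlist D G -> D s :=
  match x with
  | VZ _ _ => fun e => e.1
  | VS _ _ _ y => fun e => lookup y e.2
  end.

Record signature := Signature {
  fun_sym : Type;
  fun_ar : fun_sym -> nat;
  rel_sym : Type;
  rel_ar : rel_sym -> nat }.

Inductive term (S : signature) (G : seq sort) : Type :=
| TVar of var G Ind
| TFun (f : fun_sym S) of {ffun 'I_(fun_ar f) -> term S G}.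

(* Equality is a logical symbol, hence not part of the signature. *)
Inductive formula (S : signature) (G : seq sort) : Type :=
| FEq of term S G & term S G
| FSym (r : rel_sym S) of {ffun 'I_(rel_ar r) -> term S G}
| FRel (n : posnat) of var G (Rel n) & {ffun 'I_n -> term S G}
| FThird (tau : type3) of
    var G (Third tau) & hlist (fun n => var G (Rel n)) tau
| FNot of formula S G
| FAnd of formula S G & formula S G
| FOr of formula S G & formula S G
| FImp of formula S G & formula S G
| FAll (s : sort) of formula S (s :: G)
| FEx (s : sort) of formula S (s :: G).

Definition third_sort (s : sort) : bool := if s is Third _ then true else false.

(* Second-order logic is the fragment of the third-order language without
   third-order variables. *)
Fixpoint second_order (S : signature) (G : seq sort) (phi : formula S G) :
    bool :=
  match phi with
  | FEq _ _ | FSym _ _ | FRel _ _ _ => true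
  | FThird _ _ _ => false
  | FNot p => second_order p
  | FAnd p q | FOr p q | FImp p q => second_order p && second_order q
  | FAll s p | FEx s p => ~~ third_sort s && second_order p
  end.

Record structure (S : signature) := Structure {
  dom :> Type;
  fun_int : forall f : fun_sym S, {ffun 'I_(fun_ar f) -> dom} -> dom;
  rel_int : forall r : rel_sym S, set {ffun 'I_(rel_ar r) -> dom} }.

Definition relation_on (D : Type) (n : posnat) : Type := set {ffun 'I_n -> D}.

Definition object3 (D : Type) (tau : type3) : Type :=
  set (hlist (relation_on D) tau).

Definition sort_dom (D : Type) (s : sort) : Type :=
  match s with
  | Ind => D
  | Rel n => relation_on D n
  | Third tau => object3 D tau
  end.

Definition env (D : Type) (G : seq sort) : Type := hlist (sort_dom D) G.

Fixpoint eval (S : signature) (M : structure S) (G : seq sort) (e : env M G)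
    (t : term S G) : M :=
  match t with
  | TVar x => lookup x e
  | TFun f ts => fun_int [ffun i => eval e (ts i)]
  end.

Fixpoint sat (S : signature) (M : structure S) (G : seq sort)
    (phi : formula S G) : env M G -> Prop :=
  match phi with
  | FEq t u => fun e => eval e t = eval e u
  | FSym r ts => fun e => rel_int [ffun i => eval e (ts i)]
  | FRel n X ts => fun e =>
      (lookup X e : relation_on M n) [ffun i => eval e (ts i)]
  | FThird tau a As => fun e =>
      (lookup a e : object3 M tau)
        (hmap (fun n (X : var G (Rel n)) => lookup X e : relation_on M n) As)
  | FNot p => fun e => ~ sat p e
  | FAnd p q => fun e => sat p e /\ sat q e
  | FOr p q => fun e => sat p e \/ sat q e
  | FImp p q => fun e => sat p e -> sat q e
  | FAll s p => fun e =>
      forall x : sort_dom M s, sat p ((x, e) : env M (s :: G))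
  | FEx s p => fun e =>
      exists x : sort_dom M s, sat p ((x, e) : env M (s :: G))
  end.

Definition sentence (S : signature) : Type := formula S [::].

Definition models (S : signature) (M : structure S) (phi : sentence S) : Prop :=
  @sat S M [::] phi tt.

(* The atomic proposition p_i is represented by its index i. *)
Definition trace : Type := nat -> set nat.

Inductive trace_rel := TraceLe | TraceP of nat.

Definition trace_sig : signature :=
  @Signature void (fun=> 0) trace_rel
    (fun r => if r is TraceLe then 2 else 1).

Definition trace_structure (T : set trace) : structure trace_sig :=
  @Structure trace_sig (T * nat)%type
    (fun f => match f with end)
    (fun r => match r return set {ffun 'I_(@rel_ar trace_sig r) -> T * nat} with
       | TraceLe => [set v | (v ord0).1 = (v ord_max).1 /\
                             (v ord0).2 <= (v ord_max).2]
       | TraceP i => [set v | val (v ord0).1 (v ord0).2 i]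
       end).

Inductive arith_fun := APlus | ATimes | AZero | AOne.

Definition arith_sig : signature :=
  @Signature arith_fun
    (fun f => match f with APlus | ATimes => 2 | AZero | AOne => 0 end)
    unit (fun=> 2).

Definition arith_structure : structure arith_sig :=
  @Structure arith_sig nat
    (fun f => match f return {ffun 'I_(@fun_ar arith_sig f) -> nat} -> nat with
       | APlus => fun v => v ord0 + v ord_max
       | ATimes => fun v => v ord0 * v ord_max
       | AZero => fun=> 0
       | AOne => fun=> 1
       end)
    (fun=> [set v | v ord0 <= v ord_max]).

Definition two : posnat := @PosNat 2 isT.

(* The type written ((2)): objects of this type are subsets of P(N^2). *)
Definition type_2 : type3 := @Type3 [:: two] isT.

Definition arith_formula_2 : Type := formula arith_sig [:: Third type_2].

Definition arith_models_2 (psi : arith_formula_2) (A : object3 nat type_2) :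
    Prop :=
  @sat arith_sig arith_structure [:: Third type_2] psi (A, tt).

Definition encode_trace (t : trace) : relation_on nat two :=
  [set v : {ffun 'I_2 -> nat} | t (v ord0) (v ord_max)].

Definition encode_team (T : set trace) : object3 nat type_2 :=
  [set ((encode_trace t, tt) : hlist (relation_on nat) type_2) | t in T].

(* Main.v *)
Require Import Defs.
From mathcomp Require Import all_boot.
From mathcomp Require Import boolp classical_sets.

(** An element [(t, j)] of the trace structure is represented by one binary
    relation on the naturals: row [0] is the singleton [{j}] and row [a + 1] is
    row [a] of the encoding of [t].  First-order variables thus become binary
    relation variables, relativized to the codes of elements of the team, and a
    relation variable of arity [n] becomes a third-order variable of type
    [(2, ..., 2)].  The latter needs no relativization, since only its
    tuples of codes are ever consulted. *)

Set Implicit Arguments.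
Unset Strict Implicit.
Unset Printing Implicit Defensive.
Local Open Scope classical_set_scope.

(** * Argument lists of constant type and binary relations on the naturals *)

Fixpoint hlist_of (A : Type) (D : A -> Type) (a : A) (n : nat) :
    ('I_n -> D a) -> hlist D (nseq n a) :=
  match n with
  | 0 => fun=> tt
  | _.+1 => fun f => (f ord0, hlist_of (fun i => f (lift ord0 i)))
  end.

Lemma eq_hlist_of (A : Type) (D : A -> Type) (a : A) (n : nat)
    (f g : 'I_n -> D a) : f =1 g -> hlist_of f = hlist_of g.
Proof. by move=> /funext ->. Qed.

Lemma hlist_of_inj (A : Type) (D : A -> Type) (a : A) (n : nat)
    (f g : 'I_n -> D a) : hlist_of f = hlist_of g -> f =1 g.
Proof.
elim: n f g => [|n IHn] f g /=; first by move=> _ [].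
case=> fg0 /IHn fgS i.
by case: (unliftP ord0 i) => [j ->|->]; [exact: fgS | exact: fg0].
Qed.

Lemma hmap_hlist_of (A : Type) (D E : A -> Type) (f : forall a, D a -> E a)
    (a : A) (n : nat) (g : 'I_n -> D a) :
  hmap f (hlist_of g) = hlist_of (fun i => f a (g i)).
Proof. by elim: n g => //= n IHn g; rewrite IHn. Qed.

Definition pair_fun (T : Type) (x y : T) : {ffun 'I_2 -> T} :=
  [ffun i => if i == ord0 then x else y].

Lemma pair_fun0 (T : Type) (x y : T) : pair_fun x y ord0 = x.
Proof. by rewrite ffunE. Qed.

Lemma pair_fun1 (T : Type) (x y : T) : pair_fun x y ord_max = y.
Proof. by rewrite ffunE. Qed.

Lemma pair_fun_eta (T : Type) (v : {ffun 'I_2 -> T}) :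
  pair_fun (v ord0) (v ord_max) = v.
Proof.
apply/ffunP => i; rewrite ffunE; case: eqP => [->//|/eqP i0].
by congr (v _); apply/val_inj; case: i i0 => [[|[|]]].
Qed.

Lemma rel2_ext (R S : relation_on nat two) :
  (forall a b, R (pair_fun a b) <-> S (pair_fun a b)) -> R = S.
Proof.
by move=> RS; apply/seteqP; split=> v; rewrite -(pair_fun_eta v) => /RS.
Qed.

(** * Building blocks for arithmetic formulas *)

Section ArithmeticFormulas.
Variable G : seq Defs.sort.
Implicit Types (X Y : var G (Rel two)) (t u : term arith_sig G).
Implicit Type e : env arith_structure G.

Definition zero : term arith_sig G :=
  @TFun arith_sig G AZero (ffun0 (card_ord 0)).

Definition one : term arith_sig G :=
  @TFun arith_sig G AOne (ffun0 (card_ord 0)).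

Definition succ t : term arith_sig G :=
  @TFun arith_sig G APlus (pair_fun t one).

Definition numeral n : term arith_sig G := iter n succ zero.

Definition le_fm t u : formula arith_sig G :=
  @FSym arith_sig G tt (pair_fun t u).

Definition rel2_fm X t u : formula arith_sig G :=
  @FRel arith_sig G two X (pair_fun t u).

Definition iff_fm (p q : formula arith_sig G) : formula arith_sig G :=
  FAnd (FImp p q) (FImp q p).

Lemma eval_succ e t : eval e (succ t) = (eval e t).+1.
Proof. by rewrite /= !ffunE /= addn1. Qed.

Lemma eval_numeral e n : eval e (numeral n) = n.
Proof. by elim: n => //= n IHn; rewrite !ffunE /= addn1 IHn. Qed.

Lemma sat_le e t u : sat (le_fm t u) e <-> eval e t <= eval e u.
Proof. by rewrite /= !ffunE. Qed.

Lemma sat_rel2 e X t u :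
  sat (rel2_fm X t u) e <->
  (lookup X e : relation_on nat two) (pair_fun (eval e t) (eval e u)).
Proof.
rewrite /=; have -> // : [ffun i => eval e (pair_fun t u i)] =
  pair_fun (eval e t) (eval e u) :> {ffun 'I_2 -> nat}.
by apply/ffunP => i; rewrite !ffunE; case: ifP.
Qed.

End ArithmeticFormulas.

(** Used as views, this and the next three lemmas open only the outer connectives and leave the
    subformulas folded, so that [sat_rel2] still matches them. *)
Lemma sat_and (G : seq Defs.sort) (e : env arith_structure G)
    (p q : formula arith_sig G) :
  sat (FAnd p q) e <-> sat p e /\ sat q e.
Proof. by []. Qed.

Lemma sat_ex (G : seq Defs.sort) (s : Defs.sort) (e : env arith_structure G)
    (p : formula arith_sig (s :: G)) :
  sat (FEx p) e <->
  exists x : sort_dom nat s, sat (M := arith_structure) p (x, e).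
Proof. by []. Qed.

Lemma sat_all_iff (G : seq Defs.sort) (e : env arith_structure G)
    (p q : formula arith_sig (Ind :: G)) :
  sat (FAll (iff_fm p q)) e <->
  forall a : nat, sat (M := arith_structure) p (a, e) <->
                  sat (M := arith_structure) q (a, e).
Proof. by []. Qed.

Lemma sat_all2_iff (G : seq Defs.sort) (e : env arith_structure G)
    (p q : formula arith_sig (Ind :: Ind :: G)) :
  sat (FAll (FAll (iff_fm p q))) e <->
  forall a b : nat, sat (M := arith_structure) p (b, (a, e)) <->
                    sat (M := arith_structure) q (b, (a, e)).
Proof. by []. Qed.

Arguments zero {G}.
Arguments numeral {G} n.

Definition var0 (G : seq Defs.sort) : term arith_sig (Ind :: G) :=
  TVar _ (VZ G Ind).

Definition var1 (G : seq Defs.sort) (s : Defs.sort) :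
    term arith_sig (s :: Ind :: G) :=
  TVar _ (VS s (VZ G Ind)).

Arguments var0 {G}.
Arguments var1 {G s}.

(** * Codes of elements and the formulas that speak about them *)

Definition code (t : trace) (j : nat) : relation_on nat two :=
  [set v : {ffun 'I_2 -> nat} |
    if v ord0 is a.+1 then t a (v ord_max) else v ord_max = j].

Lemma code0 (t : trace) (j b : nat) : code t j (pair_fun 0 b) = (b = j).
Proof. by rewrite /code /= pair_fun0 pair_fun1. Qed.

Lemma codeS (t : trace) (j a b : nat) : code t j (pair_fun a.+1 b) = t a b.
Proof. by rewrite /code /= pair_fun0 pair_fun1. Qed.

Lemma encode_traceE (t : trace) (a b : nat) :
  encode_trace t (pair_fun a b) = t a b.
Proof. by rewrite /encode_trace /= pair_fun0 pair_fun1. Qed.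

(** The position enters a code only through row 0, so the later rows decide equality of traces
    whatever [j] and [j'] are. *)
Lemma code_trace (t t' : trace) (j j' : nat) :
  t = t' <-> (forall a b, code t j (pair_fun a.+1 b) <->
                          code t' j' (pair_fun a.+1 b)).
Proof.
split=> [-> a b|tt']; first by rewrite !codeS.
apply/funext => a; apply/seteqP; split=> b.
- by move: (tt' a b); rewrite !codeS => -[].
- by move: (tt' a b); rewrite !codeS => -[].
Qed.

Lemma code_inj (t t' : trace) (j j' : nat) :
  code t j = code t' j' -> t = t' /\ j = j'.
Proof.
move=> eq_code; split.
  by apply/(code_trace _ _ j j') => a b; rewrite eq_code.
(* [j] lies in row 0 of [code t j], hence in that of [code t' j'], whose only member is [j']. *)
by rewrite -(code0 t' j' j) -eq_code code0.
Qed.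

Section CodeFormulas.
Variable G : seq Defs.sort.
Implicit Types X Y : var G (Rel two).
Implicit Type e : env arith_structure G.

Definition code_eq_fm X Y : formula arith_sig G :=
  FAll (s := Ind) (FAll (s := Ind)
    (iff_fm (rel2_fm (VS Ind (VS Ind X)) var1 var0)
            (rel2_fm (VS Ind (VS Ind Y)) var1 var0))).

Lemma sat_code_eq e X Y :
  sat (code_eq_fm X Y) e <-> lookup X e = lookup Y e.
Proof.
rewrite sat_all2_iff; split=> [XY|XY a b]; last by rewrite !sat_rel2 /= XY.
by apply/rel2_ext => a b; move: (XY a b); rewrite !sat_rel2.
Qed.

Definition code_le_fm X Y : formula arith_sig G :=
  FAnd
    (FAll (s := Ind) (FAll (s := Ind)
      (iff_fm (rel2_fm (VS Ind (VS Ind X)) (succ var1) var0)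
              (rel2_fm (VS Ind (VS Ind Y)) (succ var1) var0))))
    (FEx (s := Ind) (FEx (s := Ind)
      (FAnd (FAnd (rel2_fm (VS Ind (VS Ind X)) zero var1)
                  (rel2_fm (VS Ind (VS Ind Y)) zero var0))
            (le_fm var1 var0)))).

(** Row 0 of a code is a singleton, which forces the existential witnesses to be the two
    positions. *)
Lemma sat_code_le e X Y (t t' : trace) (j j' : nat) :
  lookup X e = code t j -> lookup Y e = code t' j' ->
  sat (code_le_fm X Y) e <-> t = t' /\ j <= j'.
Proof.
move=> Xe Ye; rewrite (code_trace t t' j j').
split=> [/sat_and[/sat_all2_iff XY]|[XY jj']].
  move=> /sat_ex[a /sat_ex[b /sat_and[/sat_and[]]]].
  rewrite !sat_rel2 sat_le /= Xe Ye !code0 => -> -> ?; split=> // c d.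
  by move: (XY c d); rewrite !sat_rel2 eval_succ /= Xe Ye.
split; first by apply/sat_all2_iff => a b; rewrite !sat_rel2 eval_succ /= Xe Ye.
exists j, j'; split; last exact/sat_le.
by split; rewrite sat_rel2 /= ?Xe ?Ye code0.
Qed.

(** Row [j + 1] holds the propositions true at the position [j] read off row 0. The index [i] comes
    from the predicate symbol, so a numeral can name it. *)
Definition code_prop_fm (i : nat) X : formula arith_sig G :=
  FEx (s := Ind)
    (FAnd (rel2_fm (VS Ind X) zero var0)
          (rel2_fm (VS Ind X) (succ var0) (numeral i))).

Lemma sat_code_prop e (i : nat) X (t : trace) (j : nat) :
  lookup X e = code t j -> sat (code_prop_fm i X) e <-> t j i.
Proof.
move=> Xe; split=> [/sat_ex[a /sat_and[]]|tji].
  by rewrite !sat_rel2 eval_numeral eval_succ /= Xe code0 codeS => ->.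
exists j; split; rewrite !sat_rel2 ?eval_numeral ?eval_succ /= Xe.
- by rewrite code0.
- by rewrite codeS.
Qed.

(** The team enters the translation only through this formula. Row 0 has to be pinned down as well:
    a relation with the right later rows but no single position codes no element. *)
Definition is_code_fm (a : var G (Third type_2)) X : formula arith_sig G :=
  FEx (s := Rel two)
    (FAnd
      (FAnd
        (@FThird arith_sig _ type_2 (VS (Rel two) a)
          ((VZ G (Rel two), tt) :
             hlist (fun n => var (Rel two :: G) (Rel n)) type_2))
        (FEx (s := Ind) (FAll (s := Ind)
          (iff_fm (rel2_fm (VS Ind (VS Ind (VS (Rel two) X))) zero var0)
                  (FEq var0 var1)))))
      (FAll (s := Ind) (FAll (s := Ind)
        (iff_fm
          (rel2_fm (VS Ind (VS Ind (VS (Rel two) X))) (succ var1) var0)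
          (rel2_fm (VS Ind (VS Ind (VZ G (Rel two)))) var1 var0))))).

Lemma sat_is_code e (a : var G (Third type_2)) X (T : set trace) :
  lookup a e = encode_team T ->
  sat (is_code_fm a X) e <->
  exists x : T * nat, lookup X e = code (val x.1) x.2.
Proof.
move=> ae; split=> [/sat_ex[A]|].
  move=> /sat_and[/sat_and[aA /sat_ex[j /sat_all_iff row0]] /sat_all2_iff rowS].
  have /= := aA; rewrite ae => -[t Tt [At]].
  (* The position comes from row 0; the trace is packed with its membership in [T], since the domain
     is built on the subset type. *)
  exists (SigSub (mem_set Tt), j) => /=; apply/rel2_ext => -[|c] d.
    by move: (row0 d); rewrite sat_rel2 /= code0.
  by move: (rowS c d); rewrite !sat_rel2 eval_succ /= -At encode_traceE codeS.
move=> [[t j] Xe]; apply/sat_ex; exists (encode_trace (val t)).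
apply/sat_and; split; first (apply/sat_and; split).
- by rewrite /= ae; exists (val t) => //; apply: set_mem; exact: valP.
- apply/sat_ex; exists j; apply/sat_all_iff => b.
  by rewrite sat_rel2 /= Xe code0.
- apply/sat_all2_iff => c d.
  by rewrite !sat_rel2 eval_succ /= Xe encode_traceE codeS.
Qed.

End CodeFormulas.

(** * Translation of sorts, contexts, assignments and formulas *)

Lemma size_nseq_two (n : posnat) : 0 < size (nseq n two).
Proof. by rewrite size_nseq; case: n. Qed.

Definition type_twos (n : posnat) : type3 := Type3 (size_nseq_two n).

(* The value at [Third] is arbitrary: no third-order variable occurs in a
   second-order sentence. *)
Definition tr_sort (s : Defs.sort) : Defs.sort :=
  match s with
  | Ind => Rel two
  | Rel n => Third (type_twos n)
  | Third tau => Third tau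
  end.

(** The team variable sits at the bottom of every translated context, so a sentence yields a formula
    whose only free variable is the team. *)
Fixpoint tr_ctx (G : seq Defs.sort) : seq Defs.sort :=
  if G is s :: G' then tr_sort s :: tr_ctx G' else [:: Third type_2].

Fixpoint tr_var (G : seq Defs.sort) (s : Defs.sort) (x : var G s) :
    var (tr_ctx G) (tr_sort s) :=
  match x with
  | VZ G s => VZ (tr_ctx G) (tr_sort s)
  | VS _ _ s' y => VS (tr_sort s') (tr_var y)
  end.

Fixpoint team_var (G : seq Defs.sort) : var (tr_ctx G) (Third type_2) :=
  match G with
  | [::] => VZ [::] (Third type_2)
  | s :: G' => VS (tr_sort s) (team_var G')
  end.

Definition elt_code_fm (G : seq Defs.sort) :
    formula arith_sig (Rel two :: tr_ctx G) :=
  is_code_fm (VS (Rel two) (team_var G)) (VZ (tr_ctx G) (Rel two)).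

(** The trace vocabulary has no function symbols, so terms need no translation beyond that of
    variables. *)
Definition term_var (G : seq Defs.sort) (t : term trace_sig G) : var G Ind :=
  match t with
  | TVar x => x
  | TFun f _ => match f with end
  end.

Section Translation.
Variable T : set trace.

Definition elt_code (x : T * nat) : relation_on nat two :=
  code (val x.1) x.2.

Lemma elt_code_inj : injective elt_code.
Proof.
by move=> [t j] [t' j'] /code_inj /= [/val_inj -> ->].
Qed.

Definition codes_of (n : posnat) (v : {ffun 'I_n -> T * nat}) :
    hlist (relation_on nat) (type_twos n) :=
  hlist_of (D := relation_on nat) (fun i => elt_code (v i)).

Lemma codes_of_inj (n : posnat) : injective (@codes_of n).
Proof.
move=> v w vw; apply/ffunP => i.
exact/elt_code_inj/(hlist_of_inj (D := relation_on nat) vw).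
Qed.

(** A relation rather than a function: objects that differ only outside the tuples of codes
    represent the same [R]. *)
Definition represents (s : Defs.sort) :
    sort_dom (trace_structure T) s -> sort_dom nat (tr_sort s) -> Prop :=
  match s with
  | Ind => fun x X => X = elt_code x
  | Rel n => fun R A => forall v, R v <-> A (codes_of v)
  | Third _ => fun _ _ => True
  end.

Fixpoint represents_env (G : seq Defs.sort) :
    env (trace_structure T) G -> env nat (tr_ctx G) -> Prop :=
  match G with
  | [::] => fun _ e' => e' = (encode_team T, tt)
  | s :: G' => fun e e' => represents e.1 e'.1 /\ represents_env e.2 e'.2
  end.

Lemma represents_lookup (G : seq Defs.sort) (s : Defs.sort) (x : var G s)
    (e : env (trace_structure T) G) (e' : env nat (tr_ctx G)) :
  represents_env e e' -> represents (lookup x e) (lookup (tr_var x) e').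
Proof. by elim: x e e' => [? ? ? ? []|? ? ? ? IHx ? ? [_ /IHx]]. Qed.

Lemma lookup_term_var (G : seq Defs.sort) (t : term trace_sig G)
    (e : env (trace_structure T) G) (e' : env nat (tr_ctx G)) :
  represents_env e e' ->
  lookup (tr_var (term_var t)) e' = elt_code (eval e t).
Proof. by case: t => [x|[]] /(represents_lookup x). Qed.

Lemma lookup_team_var (G : seq Defs.sort)
    (e : env (trace_structure T) G) (e' : env nat (tr_ctx G)) :
  represents_env e e' -> lookup (team_var G) e' = encode_team T.
Proof. by elim: G e e' => [? ? ->|? ? IHG ? ? [_ /IHG]]. Qed.

Lemma sat_elt_code (G : seq Defs.sort)
    (e : env (trace_structure T) G) (e' : env nat (tr_ctx G)) :
  represents_env e e' ->
  forall X : relation_on nat two,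
    sat (M := arith_structure) (elt_code_fm G) (X, e') <->
    exists x : T * nat, X = elt_code x.
Proof. by move=> ee' X; apply: sat_is_code; apply: lookup_team_var ee'. Qed.

(** The image of [R] under coding works because distinct tuples have distinct codes. Together with
    [represents_rel_surj] this transfers relation quantifiers in both directions. *)
Lemma represents_rel_total (n : posnat) (R : relation_on (T * nat) n) :
  exists A, @represents (Rel n) R A.
Proof.
exists [set codes_of v | v in R] => v; split=> [Rv|[w Rw /codes_of_inj <-//]].
by exists v.
Qed.

(** Any [A], even one with tuples that code nothing, represents its preimage under coding. *)
Lemma represents_rel_surj (n : posnat) (A : object3 nat (type_twos n)) :
  exists R, @represents (Rel n) R A.
Proof. by exists [set v | A (codes_of v)]. Qed.

End Translation.

(** By induction on [phi]. [psi] is fixed before [T] and the assignments, which keeps the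
    translation uniform in the team. *)
Lemma tr_formula (G : seq Defs.sort) (phi : formula trace_sig G) :
  second_order phi ->
  exists psi : formula arith_sig (tr_ctx G),
    forall (T : set trace) (e : env (trace_structure T) G) e',
      represents_env e e' ->
      sat phi e <-> sat (M := arith_structure) psi e'.
Proof.
elim: phi => {G} [G t u|G [|i] ts|G n X ts|//|G p IHp|G p IHp q IHq|
    G p IHp q IHq|G p IHp q IHq|G s p IHp|G s p IHp] /=.
- move=> _; exists (code_eq_fm (tr_var (term_var t)) (tr_var (term_var u))).
  move=> T e e' ee'; rewrite sat_code_eq !(lookup_term_var _ ee').
  by split=> [->|/elt_code_inj].
- move=> _; exists (code_le_fm (tr_var (term_var (ts ord0)))
                               (tr_var (term_var (ts ord_max)))).
  move=> T e e' ee'.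
  rewrite (sat_code_le (lookup_term_var _ ee') (lookup_term_var _ ee')).
  rewrite /= !ffunE.
  (* Codes see the underlying traces, while the order compares members of the subset type; [val_inj]
     bridges the two. *)
  by split=> -[tt' ?]; split=> //; [rewrite tt' | exact: val_inj].
- move=> _; exists (code_prop_fm i (tr_var (term_var (ts ord0)))).
  move=> T e e' ee'; rewrite (sat_code_prop _ (lookup_term_var _ ee')).
  by rewrite /= !ffunE.
- move=> _; exists (@FThird arith_sig _ (type_twos n) (tr_var X)
    (hlist_of (D := fun m => var (tr_ctx G) (Rel m))
      (fun i => tr_var (term_var (ts i))))).
  move=> T e e' ee'; have /= -> := represents_lookup X ee'.
  rewrite hmap_hlist_of /codes_of.
  suff eq_codes i :
      elt_code ([ffun i => eval (M := trace_structure T) e (ts i)] i) =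
      lookup (tr_var (term_var (ts i))) e' by rewrite (eq_hlist_of eq_codes).
  by rewrite ffunE (lookup_term_var _ ee').
- move=> /IHp[p' pp']; exists (FNot p') => T e e' /pp' /= pp'E.
  by rewrite pp'E.
- move=> /andP[/IHp[p' pp'] /IHq[q' qq']]; exists (FAnd p' q') => T e e' ee' /=.
  by rewrite (pp' _ _ _ ee') (qq' _ _ _ ee').
- move=> /andP[/IHp[p' pp'] /IHq[q' qq']]; exists (FOr p' q') => T e e' ee' /=.
  by rewrite (pp' _ _ _ ee') (qq' _ _ _ ee').
- move=> /andP[/IHp[p' pp'] /IHq[q' qq']]; exists (FImp p' q') => T e e' ee' /=.
  by rewrite (pp' _ _ _ ee') (qq' _ _ _ ee').
- case: s p IHp => [|n|//] p IHp /= /IHp[p' pp'].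
    (* The guard keeps the quantifier on codes. If [T] is empty, no relation passes it, which
       matches the empty domain. *)
    exists (FAll (FImp (elt_code_fm G) p')) => T e e' ee'.
    have is_codeP := sat_elt_code ee'.
    split=> [px X /is_codeP[x Xx]|pX x].
      by apply/(pp' T (x, e) (X, e')).
    apply/(pp' T (x, e) (elt_code x, e')) => //.
    by apply: pX; apply/is_codeP; exists x.
  (* Surjectivity carries the universal statement from [R] to [A] and totality carries it back; the
     existential case swaps the two. *)
  exists (FAll p') => T e e' ee'; split=> [pR A|pA R].
    have [R RA] := represents_rel_surj T A.
    by apply/(pp' T (R, e) (A, e')).
  have [A RA] := represents_rel_total R.
  by apply/(pp' T (R, e) (A, e')).
- case: s p IHp => [|n|//] p IHp /= /IHp[p' pp'].
    exists (FEx (FAnd (elt_code_fm G) p')) => T e e' ee'.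
    have is_codeP := sat_elt_code ee'.
    split=> [[x px]|[X [/is_codeP[x Xx] pX]]].
      exists (elt_code x); split; first by apply/is_codeP; exists x.
      by apply/(pp' T (x, e) (elt_code x, e')).
    by exists x; apply/(pp' T (x, e) (X, e')).
  exists (FEx p') => T e e' ee'; split=> [[R pR]|[A pA]].
    have [A RA] := represents_rel_total R.
    by exists A; apply/(pp' T (R, e) (A, e')).
  have [R RA] := represents_rel_surj T A.
  by exists R; apply/(pp' T (R, e) (A, e')).
Qed.

Theorem theorem4 (phi : sentence trace_sig) (hphi : second_order phi) :
  exists psi : arith_formula_2,
    forall T : set trace,
      models (trace_structure T) phi <-> arith_models_2 psi (encode_team T).
Proof.
have [psi phi_psi] := tr_formula hphi.
(* In the empty context [represents_env] only asks that the team variable hold [encode_team T]. *)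
by exists psi => T; exact: phi_psi.
Qed.
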